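(* Let $\mathcal{H}$ be a complex Hilbert space, let $0\leq\alpha\leq1\leq\beta$, and let $T\in\mathcal{B}(\mathcal{H})$ be an $(\alpha,\beta)$-normal operator. Then $$w^2(T)\geq\max\left\{1+\alpha^2,\ 1+\frac{1}{\beta^2}\right\}\frac{\|T\|^2}{4}+\frac{\left|\,\|\Re(T)+\Im(T)\|^2-\|\Re(T)-\Im(T)\|^2\,\right|}{4}.$$
   Context: $\mathcal{B}(\mathcal{H})$ denotes the $C^*$-algebra of all bounded linear operators on the complex Hilbert space $\mathcal{H}$, and $\|\cdot\|$ is the operator norm. For real numbers $0\leq\alpha\leq1\leq\beta$, an operator $T\in\mathcal{B}(\mathcal{H})$ is called $(\alpha,\beta)$-normal if $\alpha^2T^*T\leq TT^*\leq\beta^2T^*T$ (in the usual order of self-adjoint operators), equivalently $\alpha\|Tx\|\leq\|T^*x\|\leq\beta\|Tx\|$ for all $x\in\mathcal{H}$. The real and imaginary parts of $T$ are $\Re(T)=\frac12(T+T^* )$ and $\Im(T)=\frac{1}{2i}(T-T^* )$. The numerical radius is $w(T)=\sup\{|\langle Tx,x\rangle|: x\in\mathcal{H},\ \|x\|=1\}$, and $w^2(T)=(w(T))^2$. *)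

(* Defs.v *)
From HB Require Import structures.
From mathcomp Require Import all_boot all_order all_algebra sesquilinear.
From mathcomp Require Import all_classical all_reals all_analysis.
From mathcomp Require Export complex.

Set Implicit Arguments.
Unset Strict Implicit.
Unset Printing Implicit Defensive.

Import Order.TTheory GRing.Theory Num.Theory.
Import numFieldNormedType.Exports.

Local Open Scope classical_set_scope.
Local Open Scope ring_scope.

(* A complex Hilbert space is a Banach space H over R[i] with a positive
   definite Hermitian form (linear on the left, conjugate-linear on the right)
   that induces the norm of H. The norm of a normed module over R[i] is
   R[i]-valued, with nonnegative real values; the real-valued operator norm and
   numerical radius are therefore formed with complex.Re. *)
Definition hilbert_dot (R : realType) (H : completeNormedModType R[i])
    (dot : {dot H for Num.conj}) : Prop :=
  forall x : H, `|x| ^+ 2 = dot x x.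

Section operators.
Context {R : realType} {H : completeNormedModType R[i]}.
Variable dot : {dot H for Num.conj}.
Implicit Types T A B : H -> H.

Definition opnorm T : R :=
  sup [set complex.Re `|T x| | x in [set x : H | `|x| <= 1]].

(* The sup over the empty unit sphere of H = 0 is 0. *)
Definition numradius T : R :=
  sup [set complex.Re `|dot (T x) x| | x in [set x : H | `|x| = 1]].

(* The vector z is unique because dot is definite, and it exists, by the Riesz
   representation theorem, whenever T is a bounded operator on a Hilbert space;
   the default value 0 is then never used. *)
Definition adjoint T : H -> H :=
  fun y => xget 0 [set z | forall x, dot (T x) y = dot x z].

Definition re_op T : H -> H := 2^-1 \*: (T \+ adjoint T).

Definition im_op T : H -> H := (2 * 'i)^-1 \*: (T \- adjoint T).

(* On R[i], z <= w means that w - z is a nonnegative real number. *)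
Definition op_le A B : Prop := forall x, dot (A x) x <= dot (B x) x.

Definition ab_normal (alpha beta : R) T : Prop :=
  op_le ((alpha ^+ 2)%:C%C \*: (adjoint T \o T)) (T \o adjoint T) /\
  op_le (T \o adjoint T) ((beta ^+ 2)%:C%C \*: (adjoint T \o T)).

End operators.

(* Main.v *)
(* Let A and B be the real and imaginary parts of T. Since <Ax,x> and <Bx,x> are
   the real and imaginary parts of <Tx,x>, the self-adjoint operators A + B and
   A - B have numerical radius, hence norm, at most sqrt 2 * w(T). With
   a = |A + B|^2 and b = |A - B|^2 this gives
     w(T)^2 >= max(a, b) / 2 = (a + b) / 4 + |a - b| / 4.
   By the parallelogram law a + b >= |Tx|^2 + |T*x|^2 for x in the unit ball,
   and (alpha, beta)-normality bounds the latter below both by (1 + alpha^2) |Tx|^2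
   and by (1 + 1 / beta^2) |T*x|^2; finally |T| <= |T*|. *)
Require Import Defs.
From HB Require Import structures.
From mathcomp Require Import all_boot all_order all_algebra sesquilinear.
From mathcomp Require Import all_classical all_reals all_analysis.
From mathcomp Require Import ring lra.

Set Implicit Arguments.
Unset Strict Implicit.
Unset Printing Implicit Defensive.

Import Order.TTheory GRing.Theory Num.Theory.
Import numFieldNormedType.Exports.

Local Open Scope classical_set_scope.
Local Open Scope ring_scope.

(** [sup] is 0 on a set without a supremum, so the bound survives for empty and unbounded sets. *)
Lemma sup_nneg (R : realType) (A : set R) :
  (forall a, A a -> 0 <= a) -> 0 <= sup A.
Proof.
move=> A0; have [[[a Aa] ubA]|/sup_out -> //] := pselect (has_sup A).
exact: le_trans (A0 a Aa) (ub_le_sup ubA Aa).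
Qed.

Lemma sqr_Re_norm (R : realType) (z : R[i]) :
  complex.Re `|z| ^+ 2 = complex.Re z ^+ 2 + complex.Im z ^+ 2.
Proof. by rewrite normc_def /= sqr_sqrtr // addr_ge0 ?sqr_ge0. Qed.

Lemma Re_norm_ge0 (R : realType) (z : R[i]) : 0 <= complex.Re `|z|.
Proof. by rewrite -ler0c RRe_real. Qed.

(** * The real inner product underlying the Hermitian form *)

Section real_part.
Context {R : realType} {H : completeNormedModType R[i]}.
Variable dot : {dot H for Num.conj}.
Hypothesis hdot : hilbert_dot dot.
Implicit Types (x y z : H) (a : R).

Definition rnorm x : R := complex.Re `|x|.
Definition rdot x y : R := complex.Re (dot x y).

Lemma rnormE x : `|x| = (rnorm x)%:C%C.
Proof. by rewrite /rnorm RRe_real. Qed.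

Lemma rnorm_ge0 x : 0 <= rnorm x.
Proof. by rewrite -ler0c -rnormE. Qed.

Lemma rnorm_eq0 x : rnorm x = 0 -> x = 0.
Proof. by move=> x0; apply/normr0_eq0; rewrite rnormE x0. Qed.

Lemma rnormZ a x : rnorm (a%:C%C *: x) = `|a| * rnorm x.
Proof.
apply: complexI; rewrite -rnormE normrZ rnormE.
by rewrite normc_def /= expr0n addr0 sqrtr_sqr rmorphM.
Qed.

Lemma dotC x y : dot x y = Num.conj (dot y x).
Proof. by have := hermC dot x y; rewrite expr0 mul1r. Qed.

Lemma rdotC x y : rdot x y = rdot y x.
Proof. by rewrite /rdot dotC; case: (dot y x). Qed.

Lemma rdotDl x y z : rdot (x + y) z = rdot x z + rdot y z.
Proof. by rewrite /rdot linearDl raddfD. Qed.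

Lemma rdotDr x y z : rdot z (x + y) = rdot z x + rdot z y.
Proof. by rewrite rdotC rdotDl !(rdotC z). Qed.

Lemma rdotNl x y : rdot (- x) y = - rdot x y.
Proof. by rewrite /rdot linearNl raddfN. Qed.

Lemma rdotNr x y : rdot x (- y) = - rdot x y.
Proof. by rewrite rdotC rdotNl rdotC. Qed.

Lemma rdotZl a x y : rdot (a%:C%C *: x) y = a * rdot x y.
Proof.
by rewrite /rdot linearZl_LR /=; case: (dot x y) => u v /=; rewrite mul0r subr0.
Qed.

Lemma rdotZr a x y : rdot x (a%:C%C *: y) = a * rdot x y.
Proof. by rewrite rdotC rdotZl rdotC. Qed.

Lemma rdotil x y : rdot ('i *: x) y = - complex.Im (dot x y).
Proof. by rewrite /rdot linearZl_LR /= mulrC ReiNIm. Qed.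

Lemma rdotii x y : rdot ('i *: x) ('i *: y) = rdot x y.
Proof.
rewrite rdotil dotC linearZl_LR /= rdotC /rdot.
by case: (dot y x) => u v /=; rewrite !mul0r mul1r add0r opprK.
Qed.

(** Multiplication by i preserves [rdot] and squares to -1, hence it is skew-adjoint. *)
Lemma rdotir x y : rdot x ('i *: y) = - rdot ('i *: x) y.
Proof.
by rewrite -[in RHS]rdotii scalerA -expr2 sqrCi scaleN1r rdotNl opprK.
Qed.

Lemma rdotxx x : rdot x x = rnorm x ^+ 2.
Proof.
by rewrite /rdot -hdot rnormE -rmorphXn. Qed.

Lemma rnormDsqr x y :
  rnorm (x + y) ^+ 2 = rnorm x ^+ 2 + 2 * rdot x y + rnorm y ^+ 2.
Proof.
by rewrite -!rdotxx rdotDl !rdotDr (rdotC y x); ring.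
Qed.

Lemma rnormN x : rnorm (- x) = rnorm x.
Proof. by rewrite /rnorm normrN. Qed.

Lemma rnormBsqr x y :
  rnorm (x - y) ^+ 2 = rnorm x ^+ 2 - 2 * rdot x y + rnorm y ^+ 2.
Proof. by rewrite rnormDsqr rdotNr rnormN; ring. Qed.

Lemma parallelogram x y :
  rnorm (x + y) ^+ 2 + rnorm (x - y) ^+ 2
  = 2 * (rnorm x ^+ 2 + rnorm y ^+ 2).
Proof. by rewrite rnormDsqr rnormBsqr; ring. Qed.

(** Cauchy-Schwarz: the squared norm of |y| x - |x| y equals 2 |x| |y| (|x| |y| - <x,y>), with <x,y>
    the real inner product. *)
Lemma ler_rdot x y : rdot x y <= rnorm x * rnorm y.
Proof.
have [y0|y0] := eqVneq (rnorm y) 0.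
  by rewrite y0 mulr0 (rnorm_eq0 y0) /rdot linear0r.
have yp : 0 < rnorm y by rewrite lt_neqAle eq_sym y0 rnorm_ge0.
have := sqr_ge0 (rnorm ((rnorm y)%:C%C *: x - (rnorm x)%:C%C *: y)).
rewrite rnormBsqr rdotZl rdotZr !rnormZ !ger0_norm ?rnorm_ge0 //.
have [x0|x0] := eqVneq (rnorm x) 0.
  by rewrite (rnorm_eq0 x0) /rdot linear0l mulr_ge0 // rnorm_ge0.
have xp : 0 < rnorm x by rewrite lt_neqAle eq_sym x0 rnorm_ge0.
have -> : (rnorm y * rnorm x) ^+ 2 - 2 * (rnorm y * (rnorm x * rdot x y)) +
    (rnorm x * rnorm y) ^+ 2
  = 2 * (rnorm x * rnorm y) * (rnorm x * rnorm y - rdot x y) by ring.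
by rewrite pmulr_rge0 ?subr_ge0 // !mulr_gt0.
Qed.

Lemma normr_rdot x y : `|rdot x y| <= rnorm x * rnorm y.
Proof.
by rewrite ler_norml ler_rdot andbT lerNl -rdotNl -(rnormN x) ler_rdot.
Qed.

(** Completeness of H with real tolerances: a positive element of R[i] is real, so these are the
    only tolerances to consider. *)
Lemma rnorm_cauchy_cvg (u : H ^nat) :
  (forall e : R, 0 < e ->
    exists n, forall m, (n <= m)%N -> rnorm (u n - u m) < e) ->
  exists z, forall e : R, 0 < e ->
    exists n, forall m, (n <= m)%N -> rnorm (z - u m) < e.
Proof.
move=> cu.
have : cvg (u @ \oo).
  apply/cauchy_cvgP/cauchy_exP => e.
  rewrite ltcE /= => /andP[/eqP e0 /cu[n nu]].
  exists (u n); exists n => // m /= nm.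
  by rewrite -ball_normE /= rnormE ltcE /= e0 eqxx nu.
move=> /cvg_ex[z uz]; exists z => e e0.
have /cvgrPdist_lt/(_ e%:C%C) := uz; rewrite ltcR => /(_ e0)[n _ nu].
by exists n => m /nu /=; rewrite rnormE ltcR.
Qed.

(* The representing vector is the limit of a minimizing sequence of
   g x = |x|^2 - 2 f x. *)
Section riesz.
Variable (f : H -> R) (C : R).
Hypothesis fD : forall x y, f (x + y) = f x + f y.
Hypothesis fZ : forall a x, f (a%:C%C *: x) = a * f x.
Hypothesis fC : forall x, `|f x| <= C * rnorm x.

Let g x := rnorm x ^+ 2 - 2 * f x.

Let g_has_inf : has_inf (range g).
Proof.
split; first by exists (g 0), 0.
(* Completing the square: g x >= |x|^2 - 2 C |x| >= - C^2. *)
exists (- C ^+ 2) => _ [x _ <-]; rewrite /g.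
have := fC x; rewrite ler_norml => /andP[_ fx].
have := sqr_ge0 (rnorm x - C); nra.
Qed.

Let m := inf (range g).

Let m_le x : m <= g x.
Proof. by apply: ge_inf; [case: g_has_inf|exists x]. Qed.

Let gD t x y :
  g (x + t%:C%C *: y) = g x + t ^+ 2 * rnorm y ^+ 2 + 2 * t * (rdot x y - f y).
Proof.
rewrite /g rnormDsqr rdotZr rnormZ exprMn real_normK ?num_real// fD fZ; ring.
Qed.

(** The parallelogram law gives |x - y|^2 = 2 g x + 2 g y - 4 g ((x + y) / 2), and g is at least m
    at the midpoint. Hence minimizing sequences are Cauchy. *)
Let g_mid x y :
  rnorm (x - y) ^+ 2 <= 2 * (g x - m) + 2 * (g y - m).
Proof.
have := m_le (x + (2^-1)%:C%C *: (y - x)).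
have fB : f (y - x) = f y - f x.
  by have := fD (y - x) x; rewrite subrK => ->; ring.
rewrite gD fB rdotDr rdotNr rdotxx /g (rnormBsqr y x) rnormBsqr (rdotC y x).
by lra.
Qed.

Lemma riesz_real : exists z, forall x, f x = rdot x z.
Proof.
have [u gu] : exists u : H ^nat, forall n, g (u n) - m < n.+1%:R^-1.
  suff /choice[u gu] : forall n, exists x, g x - m < n.+1%:R^-1 by exists u.
  move=> n; have n0 : (0 : R) < n.+1%:R^-1 by rewrite invr_gt0.
  have [_ [x _ <-] gx] := inf_adherent n0 g_has_inf.
  by exists x; rewrite ltrBlDl.
have small e : 0 < e -> exists n, forall k, (n <= k)%N -> g (u k) - m < e.
  move=> e0; have [n ne] := [elaborate near_infty_natSinv_lt (PosNum e0)].
  move=> nP; exists n => k /nP; exact: lt_trans.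
have [z uz] : exists z, forall e : R, 0 < e ->
    exists n, forall k, (n <= k)%N -> rnorm (z - u k) < e.
  apply: rnorm_cauchy_cvg => e e0.
  have /small[n nP] : 0 < e ^+ 2 / 4 by rewrite divr_gt0 ?exprn_gt0.
  exists n => k nk; rewrite -(ltr_pXn2r (n:=2)) ?nnegrE ?rnorm_ge0 ?(ltW e0) //.
  apply: le_lt_trans (g_mid _ _) _.
  by have := nP n (leqnn n); have := nP k nk; lra.
exists z => x; apply/eqP; rewrite eq_sym -subr_eq0 rdotC.
set d := rdot z x - f x.
(* Compare m with g at u k + t x: g (u k) exceeds m by less than e, and replacing u k by its limit z
   costs at most 2 |t| e |x|. *)
have quad t e : 0 < e ->
    0 <= t ^+ 2 * rnorm x ^+ 2 + 2 * t * d + e * (1 + 2 * `|t| * rnorm x).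
  move=> e0; have [n1 n1P] := small e e0; have [n2 n2P] := uz e e0.
  set k := maxn n1 n2.
  have := n1P k (leq_maxl _ _); have := n2P k (leq_maxr _ _).
  have := m_le (u k + t%:C%C *: x); rewrite gD.
  have -> : rdot (u k) x - f x = d - rdot (z - u k) x.
    by rewrite rdotDl rdotNl /d; ring.
  move=> mk zk uk.
  have h : - (t * rdot (z - u k) x) <= `|t| * (e * rnorm x).
    apply: le_trans (ler_norm _) _; rewrite normrN normrM ler_wpM2l //.
    apply: le_trans (normr_rdot _ _) _.
    by rewrite ler_wpM2r ?rnorm_ge0 // ltW.
  by nra.
(* The quadratic polynomial in t is nonnegative, hence its linear coefficient
   2 d vanishes; it is tested at t = - d / (1 + |x|^2). *)
have quad0 t : 0 <= t ^+ 2 * rnorm x ^+ 2 + 2 * t * d.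
  apply/ler_addgt0Pr => e e0.
  have p : 0 < 1 + 2 * `|t| * rnorm x.
    by rewrite ltr_pwDl // !mulr_ge0 // rnorm_ge0.
  by have := quad t _ (divr_gt0 e0 p); rewrite divfK // gt_eqF.
have Nx := sqr_ge0 (rnorm x); set N := rnorm x ^+ 2 in Nx quad0 *.
have N1 : 0 < 1 + N by rewrite ltr_pwDl.
have := quad0 (- d / (1 + N)).
have -> : (- d / (1 + N)) ^+ 2 * N + 2 * (- d / (1 + N)) * d
   = - (d ^+ 2 * ((2 + N) / (1 + N) ^+ 2)).
  by field; rewrite gt_eqF.
rewrite oppr_ge0 pmulr_lle0 ?divr_gt0 ?exprn_gt0 ?ltr_pwDl // => d2.
by rewrite -sqrf_eq0 eq_le d2 sqr_ge0.
Qed.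

End riesz.

(** * The adjoint and the real and imaginary parts of a bounded operator *)

Section adjoint_operator.
Variable T : {linear H -> H}.
Hypothesis bddT : bounded_near T (nbhs (0 : H)).
Let T' := adjoint dot T.

Lemma bounded_rnorm : exists2 M, 0 <= M & forall x, rnorm (T x) <= M * rnorm x.
Proof.
have /linear_boundedP/pinfty_ex_gt0[M] := bddT.
rewrite ltcE /= => /andP[/eqP M0 M1] TM.
exists (complex.Re M); first exact: ltW.
move=> x; rewrite -lecR rmorphM /= -!rnormE; apply: le_trans (TM x) _.
by rewrite [M in M * _]complexE M0 mulr0 addr0.
Qed.

(** Riesz is applied to the real part of <Tx,y>. The imaginary part is minus the real part at i x,
    which yields the complex identity. *)
Lemma dot_adjoint x y : dot (T x) y = dot x (T' y).
Proof.
have [M M0 TM] := bounded_rnorm.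
have [z Tz] : exists z, forall x, rdot (T x) y = rdot x z.
  apply: (riesz_real (C := M * rnorm y)) => [u v|a u|u].
  - by rewrite linearD rdotDl.
  - by rewrite linearZ rdotZl.
  - apply: le_trans (normr_rdot _ _) _.
    by rewrite mulrAC ler_wpM2r // rnorm_ge0.
(* The existence of z excludes the default value of [xget]. *)
rewrite /T' /adjoint; case: xgetP => [w _ /(_ x)//|/(_ z)[] {}x].
have := Tz ('i *: x); rewrite linearZ !rdotil => /oppr_inj.
have := Tz x; rewrite /rdot.
by case: (dot x z) => a b; case: (dot _ y) => c d /= -> ->.
Qed.

Lemma rdot_adjoint x y : rdot (T x) y = rdot x (T' y).
Proof. by rewrite /rdot dot_adjoint. Qed.

Lemma rdot_adjointr x y : rdot x (T y) = rdot (T' x) y.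
Proof. by rewrite rdotC rdot_adjoint rdotC. Qed.

Lemma re_opE x : re_op dot T x = (2^-1)%:C%C *: (T x + T' x).
Proof. by rewrite /re_op /= fmorphV rmorph_nat. Qed.

(** Since 1 / (2 i) = - i / 2. The real factor is isolated because [rdot] is only real-bilinear. *)
Lemma im_opE x : im_op dot T x = (2^-1)%:C%C *: ('i *: (T' x - T x)).
Proof.
rewrite /im_op /= fmorphV rmorph_nat invfM invCi -scalerA scaleNr -scalerN.
by rewrite opprB.
Qed.

Lemma rdot_re_op x y : rdot (re_op dot T x) y = rdot x (re_op dot T y).
Proof.
by rewrite !re_opE rdotZl rdotZr rdotDl rdotDr rdot_adjoint rdot_adjointr addrC.
Qed.

Lemma rdot_im_op x y : rdot (im_op dot T x) y = rdot x (im_op dot T y).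
Proof.
have TiT' u v : rdot ('i *: T u) v = - rdot u ('i *: T' v).
  by rewrite rdotir opprK -rdot_adjoint linearZ.
rewrite !im_opE rdotZl rdotZr !scalerBr rdotDl rdotDr rdotNl rdotNr TiT' opprK.
by rewrite (rdotC x ('i *: T y)) TiT' opprK addrC (rdotC _ y).
Qed.

Lemma rdot_re_op_diag x : rdot (re_op dot T x) x = complex.Re (dot (T x) x).
Proof.
rewrite re_opE rdotZl rdotDl -rdot_adjointr (rdotC x) -/(rdot _ _).
by field.
Qed.

Lemma rdot_im_op_diag x : rdot (im_op dot T x) x = complex.Im (dot (T x) x).
Proof.
rewrite im_opE rdotZl scalerBr rdotDl rdotNl [X in X - _]rdotC rdotir.
rewrite -rdot_adjoint linearZ !rdotil.
by field.
Qed.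

(** Multiplication by i is isometric, so this is the parallelogram law for Tx and T*x. *)
Lemma re_im_op_sqr x :
  2 * (rnorm (re_op dot T x) ^+ 2 + rnorm (im_op dot T x) ^+ 2)
  = rnorm (T x) ^+ 2 + rnorm (T' x) ^+ 2.
Proof.
rewrite re_opE im_opE !rnormZ !exprMn -(rdotxx ('i *: _)) rdotii rdotxx.
rewrite -mulrDr (rnormDsqr (T x)) (rnormBsqr (T' x)) (rdotC (T' x)).
by rewrite real_normK ?num_real //; field.
Qed.

Lemma ab_normal_rnorm (alpha beta : R) : ab_normal dot alpha beta T ->
  forall x, alpha ^+ 2 * rnorm (T x) ^+ 2 <= rnorm (T' x) ^+ 2
            /\ rnorm (T' x) ^+ 2 <= beta ^+ 2 * rnorm (T x) ^+ 2.
Proof.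
move=> [nl nr] x; move: (nl x) (nr x).
rewrite !lecE => /andP[_ +] /andP[_]; rewrite /= -!/(rdot _ _) !rdotZl.
by rewrite -!(rdot_adjointr (T x)) !(rdot_adjoint (T' x)) !rdotxx.
Qed.

(** This is |T| <= |T*|: with e = Tx / |Tx|, one has |Tx| = <Tx,e> = <x,T*e>. *)
Lemma adjoint_rnorm_bound K : 0 <= K ->
  (forall x, rnorm x <= 1 -> rnorm (T' x) <= K) ->
  forall x, rnorm (T x) <= K * rnorm x.
Proof.
move=> K0 T'K x; set n := rnorm (T x).
have [n0|n0] := eqVneq n 0; first by rewrite n0 mulr_ge0 // rnorm_ge0.
have np : 0 < n by rewrite lt_neqAle eq_sym n0 rnorm_ge0.
have ne : rnorm ((n^-1)%:C%C *: T x) <= 1.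
  by rewrite rnormZ ger0_norm ?invr_ge0 ?(ltW np) // mulVf.
have -> : n = n^-1 * n ^+ 2 by field.
rewrite -rdotxx -rdotZr rdot_adjoint mulrC.
apply: le_trans (ler_rdot _ _) _.
by rewrite ler_wpM2l ?rnorm_ge0 // T'K.
Qed.

(** * The numerical radius as a quadratic bound *)

Lemma numradius_ge0 : 0 <= numradius dot T.
Proof. by apply: sup_nneg => _ [x _ <-]; rewrite -ler0c RRe_real. Qed.

Lemma dot_linearZ a x :
  dot (T (a%:C%C *: x)) (a%:C%C *: x) = (a ^+ 2)%:C%C * dot (T x) x.
Proof.
rewrite [T _]linearZ linearZl_LR linearZr_LR /= -[Num.conj _]/(conjc _).
by rewrite conjc_real mulrA -expr2 rmorphXn.
Qed.

Lemma ler_numradius x :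
  complex.Re `|dot (T x) x| <= numradius dot T * rnorm x ^+ 2.
Proof.
have [x0|x0] := eqVneq (rnorm x) 0.
  by rewrite (rnorm_eq0 x0) linear0r normr0 mulr_ge0 ?numradius_ge0 ?sqr_ge0.
have xp : 0 < rnorm x by rewrite lt_neqAle eq_sym x0 rnorm_ge0.
have [M M0 TM] := bounded_rnorm.
have nC (r : R) (z : R[i]) : 0 <= r ->
    complex.Re `|r%:C%C * z| = r * complex.Re `|z|.
  move=> r0; rewrite normrM ger0_norm ?ler0c // -[`|z|]RRe_real //=.
  by rewrite mul0r subr0.
set e := ((rnorm x)^-1)%:C%C *: x.
have ne : rnorm e = 1 by rewrite rnormZ ger0_norm ?invr_ge0 ?(ltW xp) // mulVf.
have xE : x = (rnorm x)%:C%C *: e by rewrite scalerA -rmorphM mulfV // scale1r.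
have -> : complex.Re `|dot (T x) x| = rnorm x ^+ 2 * complex.Re `|dot (T e) e|.
    by rewrite [in LHS]xE dot_linearZ nC ?sqr_ge0.
rewrite mulrC ler_wpM2r ?sqr_ge0 //; apply: ub_le_sup; last first.
  by exists e => //=; rewrite rnormE ne.
(* The supremum must be taken over a bounded set. Pairing Ty with y and with i y bounds the real and
   imaginary parts of <Ty,y> by M, so its modulus is at most 2 M. *)
exists (2 * M) => _ [y /= y1 <-].
have {}y1 : rnorm y = 1 by apply: complexI; rewrite -rnormE.
have bnd z : rnorm z = 1 -> `|rdot (T y) z| <= M.
  move=> z1; apply: le_trans (normr_rdot _ _) _.
  by rewrite z1 mulr1; have := TM y; rewrite y1 mulr1.
have yi : rnorm ('i *: y) = 1 by rewrite /rnorm normrZ normCi mul1r.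
have ib := bnd _ yi; have rb := bnd _ y1.
rewrite -[leLHS]/(complex.Re `|dot (T y) y|).
rewrite -(@ler_pXn2r _ 2) ?nnegrE ?Re_norm_ge0 ?mulr_ge0 //.
rewrite [leLHS]sqr_Re_norm.
rewrite rdotir rdotil opprK in ib.
move: ib rb => /ler_normlP[b1 b2] /ler_normlP[a1 a2].
by rewrite /rdot in a1 a2; nra.
Qed.

End adjoint_operator.

(* Polarization of <Sx,y> at y = t Sx with t = 1 / c. *)
Lemma self_adjoint_rnorm (S : H -> H) c : 0 <= c ->
  (forall x y, rdot (S x) y = rdot x (S y)) ->
  (forall x, `|rdot (S x) x| <= c * rnorm x ^+ 2) ->
  forall x, rnorm (S x) <= c * rnorm x.
Proof.
move=> c0 Ssym Sc x.
(* S is a bare function; the additivity required for polarization is derived weakly, from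
   symmetry. *)
have SD u v w : rdot (S (u + v)) w = rdot (S u) w + rdot (S v) w.
  by rewrite !Ssym rdotDl.
have SN u w : rdot (S (- u)) w = - rdot (S u) w by rewrite !Ssym rdotNl.
have polar y : 4 * rdot (S x) y <= 2 * c * (rnorm x ^+ 2 + rnorm y ^+ 2).
  have -> : 4 * rdot (S x) y
     = rdot (S (x + y)) (x + y) - rdot (S (x - y)) (x - y).
    by rewrite !SD !SN !rdotDr !rdotNr (Ssym y x) (rdotC y); ring.
  have := Sc (x + y).
  have := Sc (x - y) => /ler_normlP[m1 m2] /ler_normlP[p1 p2].
  have := parallelogram x y.
  by nra.
rewrite -(ler_pXn2r (n:=2)) ?nnegrE ?mulr_ge0 ?rnorm_ge0 //.
have key t : 4 * t * rnorm (S x) ^+ 2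
    <= 2 * c * (rnorm x ^+ 2 + t ^+ 2 * rnorm (S x) ^+ 2).
  have := polar (t%:C%C *: S x).
  by rewrite rdotZr rdotxx rnormZ exprMn real_normK ?num_real // mulrA.
rewrite exprMn.
(* For c = 0 the choice t = 1 already forces Sx = 0. *)
have [c00|cn0] := eqVneq c 0.
  by have := key 1; rewrite c00; have := sqr_ge0 (rnorm (S x)); nra.
have cp : 0 < c by rewrite lt_neqAle eq_sym cn0.
have := key c^-1.
have -> : 2 * c * (rnorm x ^+ 2 + c^-1 ^+ 2 * rnorm (S x) ^+ 2)
   = 2 * c * rnorm x ^+ 2 + 2 * c^-1 * rnorm (S x) ^+ 2 by field.
move=> h; have : c^-1 * rnorm (S x) ^+ 2 <= c * rnorm x ^+ 2 by lra.
by rewrite mulrC ler_pdivrMr // => /le_trans; apply; rewrite mulrAC expr2.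
Qed.

Lemma opnorm_le (S : H -> H) c :
  (forall x, rnorm x <= 1 -> rnorm (S x) <= c) -> opnorm S <= c.
Proof.
move=> Sc; apply: ge_sup.
  by exists (rnorm (S 0)), 0 => //=; rewrite normr0.
by move=> _ [x /= x1 <-]; apply: Sc; rewrite -lecR -rnormE.
Qed.

(** The constant c only serves to make the set under the supremum bounded above. *)
Lemma le_opnorm (S : H -> H) c : (forall x, rnorm x <= 1 -> rnorm (S x) <= c) ->
  forall x, rnorm x <= 1 -> rnorm (S x) <= opnorm S.
Proof.
move=> Sc x x1; apply: ub_le_sup; last by exists x => //=; rewrite rnormE lecR.
by exists c => _ [y /= y1 <-]; apply: Sc; rewrite -lecR -rnormE.
Qed.

Lemma opnorm_ge0 (S : H -> H) : 0 <= opnorm S.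
Proof. by apply: sup_nneg => _ [x _ <-]; exact: rnorm_ge0. Qed.

End real_part.

Theorem theorem3p3 (R : realType) (H : completeNormedModType R[i])
    (dot : {dot H for Num.conj}) (hdot : hilbert_dot dot)
    (alpha beta : R) (alpha_ge0 : 0 <= alpha) (alpha_le1 : alpha <= 1)
    (beta_ge1 : 1 <= beta)
    (T : {linear H -> H}) (bddT : bounded_near T (nbhs (0 : H)))
    (normalT : ab_normal dot alpha beta T) :
  Num.max (1 + alpha ^+ 2) (1 + 1 / beta ^+ 2) * (opnorm T ^+ 2 / 4)
    + `| opnorm (re_op dot T \+ im_op dot T) ^+ 2
         - opnorm (re_op dot T \- im_op dot T) ^+ 2 | / 4
  <= numradius dot T ^+ 2.

Proof.
set w := numradius dot T; set A := re_op dot T; set B := im_op dot T.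
set a := opnorm (A \+ B); set b := opnorm (A \- B).
have w0 : 0 <= w := numradius_ge0 dot T.
(* The factor comes from (u + v)^2 <= 2 (u^2 + v^2), and likewise for u - v, with u and v the real
   and imaginary parts of <Tx,x>. *)
set c := Num.sqrt 2 * w.
have c0 : 0 <= c by rewrite mulr_ge0 ?sqrtr_ge0.
have c2 : c ^+ 2 = 2 * w ^+ 2 by rewrite exprMn sqr_sqrtr.
have ReIm x : (complex.Re (dot (T x) x)) ^+ 2 + (complex.Im (dot (T x) x)) ^+ 2
    <= (w * rnorm x ^+ 2) ^+ 2.
  rewrite -sqr_Re_norm ler_pXn2r ?nnegrE ?Re_norm_ge0 ?mulr_ge0 ?rnorm_ge0 //.
  exact: ler_numradius.
have Sp : forall x, rnorm ((A \+ B) x) <= c * rnorm x.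
  apply: (self_adjoint_rnorm hdot c0) => [x y|x] /=.
    by rewrite rdotDl rdotDr (rdot_re_op hdot bddT) (rdot_im_op hdot bddT).
  rewrite rdotDl (rdot_re_op_diag hdot bddT) (rdot_im_op_diag hdot bddT).
  rewrite -(@ler_pXn2r _ 2) ?nnegrE ?mulr_ge0 ?rnorm_ge0 //.
  rewrite real_normK ?num_real // exprMn c2; have := ReIm x; rewrite exprMn.
  move: (complex.Re _) (complex.Im _) => u v; have := sqr_ge0 (u - v); nra.
have Sm : forall x, rnorm ((A \- B) x) <= c * rnorm x.
  apply: (self_adjoint_rnorm hdot c0) => [x y|x] /=.
    by rewrite rdotDl rdotDr rdotNl rdotNr (rdot_re_op hdot bddT)
      (rdot_im_op hdot bddT).
  rewrite rdotDl rdotNl (rdot_re_op_diag hdot bddT) (rdot_im_op_diag hdot bddT).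
  rewrite -(@ler_pXn2r _ 2) ?nnegrE ?mulr_ge0 ?rnorm_ge0 //.
  rewrite real_normK ?num_real // exprMn c2; have := ReIm x; rewrite exprMn.
  move: (complex.Re _) (complex.Im _) => u v; have := sqr_ge0 (u + v); nra.
have le_c (S : H -> H) : (forall x, rnorm (S x) <= c * rnorm x) ->
    forall x, rnorm x <= 1 -> rnorm (S x) <= c.
  by move=> Sc x x1; apply: le_trans (Sc x) _; rewrite ler_piMr.
have a0 : 0 <= a := opnorm_ge0 _; have b0 : 0 <= b := opnorm_ge0 _.
have aw : a ^+ 2 <= 2 * w ^+ 2.
  by rewrite -c2 ler_pXn2r ?nnegrE //; exact/opnorm_le/le_c.
have bw : b ^+ 2 <= 2 * w ^+ 2.
  by rewrite -c2 ler_pXn2r ?nnegrE //; exact/opnorm_le/le_c.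
(* Both sides of the parallelogram law for Ax and Bx: |Tx|^2 + |T*x|^2 = |(A + B) x|^2 + |(A - B)
   x|^2. *)
have TT' x : rnorm x <= 1 ->
    rnorm (T x) ^+ 2 + rnorm (adjoint dot T x) ^+ 2 <= a ^+ 2 + b ^+ 2.
  move=> x1; rewrite -(re_im_op_sqr hdot) -(parallelogram hdot).
  apply: lerD; rewrite ler_pXn2r ?nnegrE ?rnorm_ge0 //.
    exact: (le_opnorm (le_c _ Sp)).
  exact: (le_opnorm (le_c _ Sm)).
have normT := ab_normal_rnorm hdot bddT normalT.
set s := a ^+ 2 + b ^+ 2 in TT' *.
(* Bounds on squares are turned into bounds on norms, the form in which they pass to the
   supremum. *)
have sqrt_bound K y : 0 < K -> 0 <= y -> K * y ^+ 2 <= s ->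
    y <= Num.sqrt (s / K).
  move=> K0 y0 Ky; rewrite -(ger0_norm y0) -sqrtr_sqr ler_wsqrtr //.
  by rewrite ler_pdivlMr // mulrC.
have opnorm_bound K : 0 < K ->
    (forall x, rnorm x <= 1 -> rnorm (T x) <= Num.sqrt (s / K)) ->
    K * opnorm T ^+ 2 <= s.
  move=> K0 TK; rewrite mulrC -ler_pdivlMr //.
  have q0 : 0 <= s / K by rewrite divr_ge0 ?addr_ge0 ?sqr_ge0 ?(ltW K0).
  rewrite -[leRHS]sqr_sqrtr // ler_pXn2r ?nnegrE ?sqrtr_ge0 ?opnorm_ge0 //.
  exact: opnorm_le.
suff M_bound :
    Num.max (1 + alpha ^+ 2) (1 + 1 / beta ^+ 2) * opnorm T ^+ 2 <= s.
  rewrite mulrA -mulrDl ler_pdivrMr //.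
  case: (lerP (b ^+ 2) (a ^+ 2)) => ab; rewrite /s in M_bound; lra.
have beta0 : 0 < beta ^+ 2 by rewrite exprn_gt0 // (lt_le_trans _ beta_ge1).
have K_alpha : 0 < 1 + alpha ^+ 2 by rewrite ltr_pwDl // sqr_ge0.
have K_beta : 0 < 1 + 1 / beta ^+ 2 by rewrite ltr_pwDl // divr_ge0 // ltW.
case: (lerP (1 + alpha ^+ 2)) => _; apply: opnorm_bound => // x x1.
(* Here the maximum is 1 + 1 / beta^2: the upper normality bound controls the adjoint, and the
   estimate is then transferred to T. *)
- rewrite -[leRHS]mulr1; apply: le_trans (ler_wpM2l (sqrtr_ge0 _) x1).
  apply: (adjoint_rnorm_bound hdot bddT) => [|{x1}x x1]; first exact: sqrtr_ge0.
  apply: sqrt_bound; rewrite ?rnorm_ge0 //.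
  apply: le_trans _ (TT' x x1); rewrite mulrDl !mul1r addrC lerD2r.
  by rewrite mulrC ler_pdivrMr // mulrC; case: (normT x).
(* Here the maximum is 1 + alpha^2, and the lower normality bound controls T directly. *)
- apply: sqrt_bound; rewrite ?rnorm_ge0 //.
  apply: le_trans _ (TT' x x1); rewrite mulrDl mul1r lerD2l.
  by case: (normT x).
Qed.
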